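(* Let $a<b$ be real numbers and let $f:[a,b]\to\mathbb{R}$ be differentiable with a continuous derivative on $[a,b]$. Then the taxicab arc length $L$ of the curve $y=f(x)$ over $[a,b]$ is given by $$L=\int_a^b \left(1+|f'(x)|\right)\,dx.$$
   Context: The taxicab distance between two points $(x_1,y_1)$ and $(x_2,y_2)$ of the plane is $d_t=|x_2-x_1|+|y_2-y_1|$, and the taxicab length of a line segment is the taxicab distance between its endpoints. The taxicab arc length of the curve $y=f(x)$ over $[a,b]$ is the limit of the taxicab lengths of inscribed polygonal paths: for a partition $a=x_0<x_1<\cdots<x_n=b$ with $\triangle x_k=x_k-x_{k-1}$, the polygonal path through the points $P_k=(x_k,f(x_k))$, $k=0,\ldots,n$, has taxicab length $\sum_{k=1}^n\left(\triangle x_k+|f(x_k)-f(x_{k-1})|\right)$, and $L$ is the limit of these sums as $\max_k \triangle x_k\to 0$. *)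

(* Defs.v *)
From Stdlib Require Export Reals.
From Coquelicot Require Export Coquelicot.
Open Scope R_scope.

Definition taxicab_dist (P Q : R * R) : R :=
  Rabs (fst Q - fst P) + Rabs (snd Q - snd P).

(* Taxicab length of the polygonal path P 0, ..., P n. *)
Definition taxicab_path_length (P : nat -> R * R) (n : nat) : R :=
  sum_n_m (fun k => taxicab_dist (P (pred k)) (P k)) 1 n.

(* Only the values x 0, ..., x n matter. *)
Definition is_partition (a b : R) (n : nat) (x : nat -> R) : Prop :=
  x 0%nat = a /\ x n = b /\ forall k : nat, (k < n)%nat -> x k < x (S k).

(* The maximal step is below delta, written as a bound on every step. *)
Definition mesh_lt (n : nat) (x : nat -> R) (delta : R) : Prop :=
  forall k : nat, (k < n)%nat -> x (S k) - x k < delta.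

(* L is the limit, as the mesh tends to 0, of the taxicab lengths of the
   polygonal paths inscribed in y = f(x) over [a, b]. *)
Definition is_taxicab_arc_length (f : R -> R) (a b L : R) : Prop :=
  forall eps : R, 0 < eps ->
  exists delta : R, 0 < delta /\
    forall (n : nat) (x : nat -> R),
      is_partition a b n x -> mesh_lt n x delta ->
      Rabs (taxicab_path_length (fun k => (x k, f (x k))) n - L) < eps.

(* Main.v *)
Require Import Defs.
From Stdlib Require Import Reals Lra Lia.
From Coquelicot Require Import Coquelicot.
Open Scope R_scope.

(** Put [g x = 1 + |f' x|] and [G t] for the integral of [g] from [a] to [t].
    On a step [[u, v]] of a partition the mean value theorem applies twice: to
    [f], so that the segment has taxicab length [g c * (v - u)] for some [c] in
    the step ([taxicab_segment_mean_value]), and to [G], so that the integral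
    over the step is [g d * (v - u)] for some [d] in the step.  Uniform
    continuity of [g] makes [|g c - g d|] at most [eta] once the mesh is small;
    the errors, at most [eta * (v - u)] per step, sum to at most
    [eta * (b - a)], while the values of [G] telescope
    ([taxicab_path_length_telescope]).

    The hypotheses on [f] and [f'] hold only relatively to [[a, b]], whereas the
    calculus theorems want two-sided limits.  Composing with the retraction
    [clamp a b] of the line onto [[a, b]] turns a function continuous on
    [[a, b]] into a continuous function on the line
    ([continuous_comp_clamp]), with the same values on [[a, b]]. *)

(** * Extension from an interval to the line *)

Definition clamp (a b x : R) : R := Rmax a (Rmin b x).

Lemma clamp_in (a b x : R) : a <= b -> a <= clamp a b x <= b.
Proof.
  intros Hab; unfold clamp, Rmax, Rmin.
  destruct (Rle_dec b x); destruct (Rle_dec a _); lra.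
Qed.

Lemma clamp_id (a b x : R) : a <= x <= b -> clamp a b x = x.
Proof.
  intros Hx; unfold clamp, Rmax, Rmin.
  destruct (Rle_dec b x); destruct (Rle_dec a _); lra.
Qed.

Lemma clamp_lipschitz (a b x y : R) :
  a <= b -> Rabs (clamp a b y - clamp a b x) <= Rabs (y - x).
Proof.
  intros Hab; unfold clamp, Rmax, Rmin.
  destruct (Rle_dec b x); destruct (Rle_dec b y);
    repeat destruct (Rle_dec a _);
    unfold Rabs; repeat destruct Rcase_abs; lra.
Qed.

Lemma continuous_comp_clamp (a b : R) (h : R -> R) (x : R) :
  a <= b -> continuous_on (fun y => a <= y <= b) h ->
  continuous (fun y => h (clamp a b y)) x.
Proof.
  intros Hab Hh.
  apply (filterlim_comp _ _ _ (clamp a b) h _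
           (within (fun y => a <= y <= b) (locally (clamp a b x)))).
  - intros P [d HP]; exists d; intros y Hy.
    apply HP; [ | now apply clamp_in].
    apply Rle_lt_trans with (2 := Hy).
    now apply clamp_lipschitz.
  - apply Hh; now apply clamp_in.
Qed.

Lemma D_in_continuous_on (D : R -> Prop) (f f' : R -> R) :
  (forall x, D x -> D_in f f' D x) -> continuous_on D f.
Proof.
  intros Hf x Hx P [e HP].
  destruct (cont_deriv f f' D x (Hf x Hx) e (cond_pos e)) as [d [Hd Hlim]].
  exists (mkposreal d Hd); intros y Hy HDy.
  apply HP.
  destruct (Req_dec x y) as [<- | Hxy]; [apply ball_center | ].
  apply (Hlim y); repeat split; auto.
Qed.

Lemma D_in_is_derive (a b : R) (f f' : R -> R) (x : R) :
  a < x < b -> D_in f f' (fun y => a <= y <= b) x -> is_derive f x (f' x).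
Proof.
  intros Hx Hf; apply is_derive_Reals; intros e He.
  destruct (Hf e He) as [d [Hd Hlim]].
  assert (Hm : 0 < Rmin d (Rmin (x - a) (b - x))).
  { repeat apply Rmin_pos; lra. }
  exists (mkposreal _ Hm); intros h Hh Hhm; simpl in Hhm.
  apply Rmin_Rgt_l in Hhm as [Hhd Hhab].
  apply Rmin_Rgt_l in Hhab as [Hha Hhb].
  apply Rabs_def2 in Hha; apply Rabs_def2 in Hhb.
  specialize (Hlim (x + h)); simpl in Hlim; unfold Rdist in Hlim.
  replace (x + h - x) with h in Hlim by ring.
  apply Hlim; repeat split; lra.
Qed.

(** * Lengths of inscribed segments and paths *)

(** At an end of [[a, b]] only one-sided information on [f] is available.  The
    mean value theorem is applied to the continuous extension of [f], whose
    derivative it requires only inside [[u, v]]. *)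
Lemma mean_value_D_in (a b : R) (f f' : R -> R) (u v : R) :
  (forall x, a <= x <= b -> D_in f f' (fun y => a <= y <= b) x) ->
  a <= u -> u < v -> v <= b ->
  exists c, u <= c <= v /\ f v - f u = f' c * (v - u).
Proof.
  intros Hf Hau Huv Hvb.
  destruct (MVT_gen (fun x => f (clamp a b x)) u v f') as [c [Hc Heq]].
  - rewrite Rmin_left, Rmax_right by lra; intros x Hx.
    apply is_derive_ext_loc with f.
    + assert (Hm : 0 < Rmin (x - a) (b - x)) by (apply Rmin_pos; lra).
      exists (mkposreal _ Hm); intros y Hy.
      apply Rmin_Rgt_l in Hy as [Hya Hyb].
      apply Rabs_def2 in Hya; apply Rabs_def2 in Hyb.
      unfold minus, plus, opp in Hya, Hyb; simpl in Hya, Hyb.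
      rewrite clamp_id; [reflexivity | lra].
    + apply (D_in_is_derive a b); [lra | apply Hf; lra].
  - intros x _; apply continuity_pt_filterlim.
    apply (continuous_comp_clamp a b f); [lra | ].
    now apply D_in_continuous_on with f'.
  - rewrite Rmin_left, Rmax_right in Hc by lra.
    rewrite !clamp_id in Heq by lra.
    now exists c.
Qed.

Lemma taxicab_segment_mean_value (a b : R) (f f' : R -> R) (u v : R) :
  (forall x, a <= x <= b -> D_in f f' (fun y => a <= y <= b) x) ->
  a <= u -> u < v -> v <= b ->
  exists c, u <= c <= v /\
    taxicab_dist (u, f u) (v, f v) = (1 + Rabs (f' c)) * (v - u).
Proof.
  intros Hf Hau Huv Hvb.
  destruct (mean_value_D_in a b f f' u v Hf Hau Huv Hvb) as [c [Hc Heq]].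
  exists c; split; [exact Hc | ].
  unfold taxicab_dist; simpl.
  rewrite Heq, Rabs_mult, (Rabs_right (v - u)) by lra; ring.
Qed.

(** If each segment is within [w (S k) - w k] of the increment of [H], both the
    increments and the error bounds telescope. *)
Lemma taxicab_path_length_telescope (P : nat -> R * R) (H w : nat -> R) (n : nat) :
  (forall k, (k < n)%nat ->
     Rabs (taxicab_dist (P k) (P (S k)) - (H (S k) - H k)) <= w (S k) - w k) ->
  Rabs (taxicab_path_length P n - (H n - H 0%nat)) <= w n - w 0%nat.
Proof.
  unfold taxicab_path_length; induction n as [ | n IHn]; intros Hstep.
  - rewrite sum_n_m_zero by lia.
    replace (zero - (H 0%nat - H 0%nat)) with 0
      by (unfold zero; simpl; ring).
    rewrite Rabs_R0; lra.
  - rewrite sum_n_Sm by lia; unfold plus; simpl.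
    assert (Hlast := Hstep n (Nat.lt_succ_diag_r n)).
    assert (Hinit := IHn (fun k Hk => Hstep k (Nat.lt_lt_succ_r _ _ Hk))).
    apply Rabs_le_between in Hlast; apply Rabs_le_between in Hinit.
    apply Rabs_le; lra.
Qed.

Lemma partition_monotone (n : nat) (x : nat -> R) :
  (forall k, (k < n)%nat -> x k < x (S k)) ->
  forall i j, (i <= j)%nat -> (j <= n)%nat -> x i <= x j.
Proof.
  intros Hx i j Hij; induction Hij as [ | j Hij IH]; intros Hj; [lra | ].
  assert (Hlt := Hx j Hj).
  assert (Hle := IH (Nat.lt_le_incl _ _ Hj)); lra.
Qed.

Theorem mainTheorem1 (a b : R) (f f' : R -> R)
  (hab : a < b)
  (hderiv : forall x : R, a <= x <= b -> D_in f f' (fun y => a <= y <= b) x)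
  (hcont : continuous_on (fun y => a <= y <= b) f') :
  ex_RInt (fun x => 1 + Rabs (f' x)) a b /\
  is_taxicab_arc_length f a b (RInt (fun x => 1 + Rabs (f' x)) a b).
Proof.
  set (g := fun x => 1 + Rabs (f' (clamp a b x))).
  assert (Hg : forall x, continuous g x).
  { intros x; apply (continuous_plus (fun _ => 1)); [apply continuous_const | ].
    apply (continuous_comp (fun y => f' (clamp a b y)) Rabs).
    - apply continuous_comp_clamp; [lra | exact hcont].
    - apply continuous_Rabs. }
  assert (Hint : forall t, ex_RInt g a t).
  { intros t; apply (ex_RInt_continuous g); intros z _; apply Hg. }
  assert (Hgf : forall x, a <= x <= b -> g x = 1 + Rabs (f' x)).
  { intros x Hx; unfold g; now rewrite clamp_id. }
  assert (Hgf' : forall x, Rmin a b < x < Rmax a b -> g x = 1 + Rabs (f' x)).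
  { rewrite Rmin_left, Rmax_right by lra; intros x Hx; apply Hgf; lra. }
  split; [exact (ex_RInt_ext g _ a b Hgf' (Hint b)) | ].
  rewrite <- (RInt_ext g _ a b Hgf').
  set (G := fun t => RInt g a t).
  assert (HG : forall t, is_derive G t (g t)).
  { intros t; apply (is_derive_RInt g G a t); [ | apply Hg].
    apply filter_forall; intros s; apply (RInt_correct g), Hint. }
  intros eps Heps.
  (* The total error is at most [eta * (b - a)], half of [eps]. *)
  assert (Heta : 0 < eps / (2 * (b - a))) by (apply Rdiv_lt_0_compat; lra).
  set (eta := mkposreal _ Heta).
  destruct (unifcont_1d g a b (fun x _ => Hg x) eta) as [delta Hdelta].
  exists delta; split; [apply cond_pos | ].
  intros n x [Hx0 [Hxn Hinc]] Hmesh.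
  assert (Herr : Rabs (taxicab_path_length (fun k => (x k, f (x k))) n
                       - (G (x n) - G (x 0%nat)))
                 <= eta * x n - eta * x 0%nat).
  { apply (taxicab_path_length_telescope _ (fun k => G (x k)) (fun k => eta * x k)).
    intros k Hk.
    assert (Hlt := Hinc k Hk); assert (Hsmall := Hmesh k Hk).
    assert (Hlow := partition_monotone n x Hinc 0 k ltac:(lia) ltac:(lia)).
    assert (Hup := partition_monotone n x Hinc (S k) n ltac:(lia) ltac:(lia)).
    destruct (taxicab_segment_mean_value a b f f' (x k) (x (S k)) hderiv
                ltac:(lra) Hlt ltac:(lra)) as [c [Hc Hseg]].
    destruct (MVT_gen G (x k) (x (S k)) g) as [d [Hd HGd]].
    - intros t _; apply HG.
    - intros t _; apply continuity_pt_filterlim.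
      apply (ex_derive_continuous G); now exists (g t).
    - rewrite Rmin_left, Rmax_right in Hd by lra.
      rewrite Hseg, HGd, <- Hgf by lra.
      assert (Hclose : Rabs (g c - g d) < eta).
      (* [Hdelta] bounds the difference only up to a double negation, which
         decidability of the order removes. *)
      { destruct (Rlt_dec (Rabs (g c - g d)) eta) as [Hyes | Hno]; [exact Hyes | ].
        exfalso; apply (Hdelta d c); [lra | lra | | exact Hno].
        apply Rabs_def1; unfold minus, plus, opp; simpl; lra. }
      rewrite <- Rmult_minus_distr_r, <- Rmult_minus_distr_l.
      rewrite Rabs_mult, (Rabs_right (x (S k) - x k)) by lra.
      apply Rmult_le_compat_r; lra. }
  rewrite Hxn, Hx0 in Herr.
  replace (G a) with 0 in Herr by (symmetry; apply (RInt_point a g)).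
  rewrite Rminus_0_r in Herr; fold (G b).
  apply Rle_lt_trans with (1 := Herr).
  replace (eta * b - eta * a) with (eps / 2); [lra | ].
  unfold eta; simpl; field; lra.
Qed.
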